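(* Let $\mathcal{A}$ be an $s\ell$-enriched category, $\mathcal{B}$ an $s\ell$-generating collection of objects of $\mathcal{A}$ (viewed as a full subcategory), $T,T':\mathcal{A}\to s\ell_0$ two $s\ell$-functors and $L$ a sup-lattice. If $\lambda_C:TC\otimes T'C\to L$ ($C\in\mathcal{B}$) is a $\lozenge$-cone defined on $\mathcal{B}$, then there are unique $\lambda_X:TX\otimes T'X\to L$ for all objects $X\in\mathcal{A}$ forming a $\lozenge$-cone on $\mathcal{A}$ extending $\lambda$.
   Context: Work over a base topos $\mathcal{S}$; $s\ell$ is the category of sup-lattices and $s\ell_0$ its full subcategory of power objects $\Omega^X$ (isomorphic to the category of relations of $\mathcal{S}$; each $\Omega^X$ is self-dual, and for a linear map $g$ between such objects $g^\wedge$ denotes its dual, corresponding to the opposite relation). $\mathcal{B}$ is $s\ell$-generating if for every $X\in\mathcal{A}$, $1_X=\bigvee\{f\circ r: r,f\text{ arrows of }\mathcal{A},\ \mathrm{cod}(r)=\mathrm{dom}(f)\in\mathcal{B},\ f\circ r\le1_X\}$. A family $\lambda_X:TX\otimes T'X\to L$ is a $\lozenge$-cone (on $\mathcal{A}$, resp. on $\mathcal{B}$) if for every arrow $f:X\to Y$ (of $\mathcal{A}$, resp. between objects of $\mathcal{B}$), $\lambda_X\circ(TX\otimes T'(f)^\wedge)=\lambda_Y\circ(T(f)\otimes T'Y)$ as maps $TX\otimes T'Y\to L$; internally, for $c\in TX$, $y'\in T'Y$: $\lambda_Y(T(f)c\otimes y')=\bigvee_{x'\in T'X}[\![T'(f)x'=y']\!]\cdot\lambda_X(c\otimes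 x')$. *)

(* Defs.v *)
(* The base topos S is modelled by Rocq's own type theory
   (types = objects of S, Prop = Omega, with propositional/functional
   extensionality). *)
From Stdlib Require Import PropExtensionality FunctionalExtensionality.
Set Implicit Arguments.
Unset Strict Implicit.

Record SupLattice := {
  sl_car :> Type;
  sl_le : sl_car -> sl_car -> Prop;
  sl_join : (sl_car -> Prop) -> sl_car;
  sl_le_refl : forall x, sl_le x x;
  sl_le_trans : forall x y z, sl_le x y -> sl_le y z -> sl_le x z;
  sl_le_antisym : forall x y, sl_le x y -> sl_le y x -> x = y;
  sl_join_ub : forall (S : sl_car -> Prop) x, S x -> sl_le x (sl_join S);
  sl_join_least : forall (S : sl_car -> Prop) u,
      (forall x, S x -> sl_le x u) -> sl_le (sl_join S) u
}.

Definition image (A B : Type) (f : A -> B) (S : A -> Prop) : B -> Prop :=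
  fun y => exists x, S x /\ y = f x.

Definition is_linear (L M : SupLattice) (f : L -> M) : Prop :=
  forall S : L -> Prop, f (sl_join S) = sl_join (image f S).

(* linear maps  L1 (x) L2 -> M  are represented, via the universal property
   of the tensor product, by bimorphisms (maps linear in each variable). *)
Definition is_bimorphism (L1 L2 M : SupLattice) (g : L1 -> L2 -> M) : Prop :=
  (forall b, is_linear (L:=L1) (M:=M) (fun a => g a b)) /\
  (forall a, is_linear (L:=L2) (M:=M) (g a)).

Definition Pow (X : Type) : Type := X -> Prop.

Lemma pow_antisym (X : Type) (A B : Pow X) :
  (forall x, A x -> B x) -> (forall x, B x -> A x) -> A = B.
Proof.
  intros H1 H2; apply functional_extensionality; intro x;
  apply propositional_extensionality; split; auto.
Qed.

Definition PowSL (X : Type) : SupLattice.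
Proof.
  refine {| sl_car := Pow X;
            sl_le := fun A B => forall x, A x -> B x;
            sl_join := fun F => fun x => exists A, F A /\ A x |}.
  - auto.
  - auto.
  - apply pow_antisym.
  - intros S A HS x Hx; exists A; auto.
  - intros S u H x [A [HA Hx]]; exact (H A HA x Hx).
Defined.

Definition sing (X : Type) (x : X) : Pow X := fun z => z = x.

(* dual g^ of a linear map g : Omega^X -> Omega^Y: the linear map
   Omega^Y -> Omega^X of the opposite relation, where g corresponds to the
   relation R x y := y \in g {x}. *)
Definition dual (X Y : Type) (g : Pow X -> Pow Y) : Pow Y -> Pow X :=
  fun S x => exists y, S y /\ g (sing x) y.

Record SlCat := {
  ob : Type;
  hom : ob -> ob -> SupLattice;
  comp : forall X Y Z, hom Y Z -> hom X Y -> hom X Z;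
  idm : forall X, hom X X;
  comp_assoc : forall X Y Z W (h : hom Z W) (g : hom Y Z) (f : hom X Y),
      comp h (comp g f) = comp (comp h g) f;
  comp_id_l : forall X Y (f : hom X Y), comp (idm Y) f = f;
  comp_id_r : forall X Y (f : hom X Y), comp f (idm X) = f;
  comp_bimorphism : forall X Y Z,
      is_bimorphism (L1:=hom Y Z) (L2:=hom X Y) (M:=hom X Z) (@comp X Y Z)
}.

Arguments comp {_ X Y Z} _ _.
Arguments idm {_} X.
Arguments hom : clear implicits.

Definition sl_generating (A : SlCat) (B : ob A -> Prop) : Prop :=
  forall X : ob A,
    idm X = sl_join (fun h : hom A X X =>
      exists (C : ob A) (r : hom A X C) (f : hom A C X),
        B C /\ h = comp f r /\ sl_le (comp f r) (idm X)).

Record SlFun (A : SlCat) := {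
  fob : ob A -> Type;                        (* T X = Omega^(fob X) *)
  fmap : forall X Y, hom A X Y -> Pow (fob X) -> Pow (fob Y);
  fmap_linear : forall X Y (f : hom A X Y),
      is_linear (L:=PowSL (fob X)) (M:=PowSL (fob Y)) (fmap f);
  fmap_comp : forall X Y Z (g : hom A Y Z) (f : hom A X Y),
      fmap (comp g f) = fun c => fmap g (fmap f c);
  fmap_id : forall X, fmap (idm X) = fun c => c;
  (* enrichment: T_{X,Y} : hom(X,Y) -> sl_0(TX,TY) preserves sups
     (sups of linear maps are computed pointwise) *)
  fmap_sup : forall X Y (S : hom A X Y -> Prop),
      fmap (sl_join S) = fun c y => exists f, S f /\ fmap f c y
}.

Arguments fob {_} _ _.
Arguments fmap {_} _ {X Y} _ _ _.

(* A family lam_X : TX (x) T'X -> L (X ranging over objects satisfying P)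
   is a diamond-cone on P: for every f : X -> Y between P-objects,
   lam_X o (TX (x) T'(f)^) = lam_Y o (T(f) (x) T'Y) on TX (x) T'Y
   (checked on generators c (x) y'). *)
Definition diamond_cone (A : SlCat) (T T' : SlFun A) (L : SupLattice)
  (P : ob A -> Prop)
  (lam : forall X : ob A, Pow (fob T X) -> Pow (fob T' X) -> L) : Prop :=
  forall (X Y : ob A) (f : hom A X Y), P X -> P Y ->
    forall (c : Pow (fob T X)) (y' : Pow (fob T' Y)),
      lam X c (dual (fmap T' f) y') = lam Y (fmap T f c) y'.

Definition tensor_arrows (A : SlCat) (T T' : SlFun A) (L : SupLattice)
  (P : ob A -> Prop)
  (lam : forall X : ob A, Pow (fob T X) -> Pow (fob T' X) -> L) : Prop :=
  forall X, P X ->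
    is_bimorphism (L1:=PowSL (fob T X)) (L2:=PowSL (fob T' X)) (M:=L) (lam X).

Arguments diamond_cone {A} T T' L P lam.
Arguments tensor_arrows {A} T T' L P lam.

(* Main.v *)
(* Since B is sl-generating, every identity 1_X is the join of the maps f o r
   with r : X -> C, f : C -> X, C in B and f o r <= 1_X.  A cone linear in its
   first variable is therefore determined by its values on B:
     lam_X (c, y') = \/_{(C, r, f)} lam_X (T f (T r c), y')
                   = \/_{(C, r, f)} lam_C (T r c, T'(f)^ y').
   This gives uniqueness, and the right-hand side defines the extension.  It is
   bilinear because joins commute with joins.  For the cone equation along
   h : X -> Y, expand 1_Y in T'(h o f)^ on one side and 1_X in c on the other:
   both sides become the join, over pairs of factorizations (C, r, f) of 1_X
   and (C', r', f') of 1_Y, of the same terms, matched by the cone equation on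
   B for r' o h o f : C -> C'. *)

Require Import Defs.
From Stdlib Require Import PropExtensionality FunctionalExtensionality.

Section IndexedJoins.

Context {L : SupLattice}.

Definition sup {I : Type} (P : I -> Prop) (F : I -> L) : L := sl_join (image F P).

Lemma le_sup {I} (P : I -> Prop) (F : I -> L) i : P i -> sl_le (F i) (sup P F).
Proof. intro Hi. apply sl_join_ub. exists i; auto. Qed.

Lemma sup_least {I} (P : I -> Prop) (F : I -> L) u :
  (forall i, P i -> sl_le (F i) u) -> sl_le (sup P F) u.
Proof. intro H. apply sl_join_least. intros x [i [Hi ->]]. auto. Qed.

Lemma eq_sup {I} (P : I -> Prop) (F G : I -> L) :
  (forall i, P i -> F i = G i) -> sup P F = sup P G.
Proof.
  intro H. apply sl_le_antisym; apply sup_least; intros i Hi.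
  - rewrite H by auto. apply le_sup; auto.
  - rewrite <- H by auto. apply le_sup; auto.
Qed.

Lemma exchange_sup {I K} (P : I -> Prop) (Q : K -> Prop) (F : I -> K -> L) :
  sup P (fun i => sup Q (F i)) = sup Q (fun k => sup P (fun i => F i k)).
Proof.
  apply sl_le_antisym; apply sup_least; intros i Hi; apply sup_least; intros k Hk.
  - apply sl_le_trans with (sup P (fun i => F i k)).
    + apply (le_sup P (fun i => F i k)); auto.
    + apply (le_sup Q (fun k => sup P (fun i => F i k))); auto.
  - apply sl_le_trans with (sup Q (F k)).
    + apply (le_sup Q (F k)); auto.
    + apply (le_sup P (fun i => sup Q (F i))); auto.
Qed.

Lemma sl_join_sup (S : L -> Prop) : sl_join S = sup S (fun x => x).
Proof.
  unfold sup. f_equal. apply functional_extensionality; intro y.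
  apply propositional_extensionality. split.
  - intro Hy. exists y; auto.
  - intros [x [Hx ->]]; auto.
Qed.

End IndexedJoins.

Lemma is_linearE {L M : SupLattice} (f : L -> M) :
  is_linear f <-> forall S, f (sl_join S) = sup S f.
Proof. reflexivity. Qed.

Lemma linear_sup {L M : SupLattice} (f : L -> M) {I} (P : I -> Prop) (F : I -> L) :
  is_linear f -> f (sup P F) = sup P (fun i => f (F i)).
Proof.
  intro Hf. unfold sup. rewrite Hf. f_equal.
  apply functional_extensionality; intro y. apply propositional_extensionality.
  split.
  - intros [x [[i [Hi ->]] ->]]. exists i; auto.
  - intros [i [Hi ->]]. exists (F i). split; [exists i|]; auto.
Qed.

Lemma sup_pow (X : Type) {I} (P : I -> Prop) (F : I -> Pow X) :
  sup (L := PowSL X) P F = fun x => exists i, P i /\ F i x.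
Proof.
  apply pow_antisym; intros x.
  - intros [A [[i [Hi ->]] Hx]]. eauto.
  - intros [i [Hi Hx]]. exists (F i). split; [exists i|]; auto.
Qed.

Lemma linear_pow_sing {X Y : Type} {g : Pow X -> Pow Y} :
  is_linear (L := PowSL X) (M := PowSL Y) g ->
  forall S, g S = fun y => exists x, S x /\ g (sing x) y.
Proof.
  intros Hg S.
  assert (HS : S = sup (L := PowSL X) S (@sing X)).
  { rewrite sup_pow. apply pow_antisym; intro x.
    - intro Hx. exists x. split; [auto | reflexivity].
    - intros [z [Hz ->]]. exact Hz. }
  rewrite HS at 1. rewrite (linear_sup (L := PowSL X) (M := PowSL Y) g _ _ Hg), sup_pow.
  reflexivity.
Qed.

Lemma dual_comp {X Y Z : Type} (g1 : Pow X -> Pow Y) (g2 : Pow Y -> Pow Z) S :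
  is_linear (L := PowSL Y) (M := PowSL Z) g2 ->
  dual (fun c => g2 (g1 c)) S = dual g1 (dual g2 S).
Proof.
  intro Hg2. apply pow_antisym; unfold dual; intro x.
  - intros [z [Hz Hxz]]. rewrite (linear_pow_sing Hg2) in Hxz.
    destruct Hxz as [y [Hxy Hyz]]. exists y. split; eauto.
  - intros [y [[z [Hz Hyz]] Hxy]]. exists z. split; auto.
    rewrite (linear_pow_sing Hg2). eauto.
Qed.

Lemma dual_linear {X Y : Type} (g : Pow X -> Pow Y) :
  is_linear (L := PowSL Y) (M := PowSL X) (dual g).
Proof.
  intro S. apply pow_antisym; unfold dual, image; intro x.
  - intros [y [[A [HA Hy]] Hxy]].
    exists (fun x => exists y, A y /\ g (sing x) y). split; [exists A|]; eauto.
  - intros [D [[A [HA ->]] [y [Hy Hxy]]]]. exists y. split; [exists A|]; auto.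
Qed.

Section SlFunctors.

Variables (A : SlCat) (T : SlFun A).

Lemma fmap_sup_family {X Y : ob A} {I} (P : I -> Prop) (F : I -> hom A X Y) c :
  fmap T (sup P F) c = sup (L := PowSL _) P (fun i => fmap T (F i) c).
Proof.
  unfold sup at 1. rewrite fmap_sup, sup_pow.
  apply pow_antisym; intro y.
  - intros [f [[i [Hi ->]] Hf]]. eauto.
  - intros [i [Hi Hf]]. exists (F i). split; [exists i|]; auto.
Qed.

Lemma dual_fmap_sup_family {X Y : ob A} {I} (P : I -> Prop) (F : I -> hom A X Y) y :
  dual (fmap T (sup P F)) y = sup (L := PowSL _) P (fun i => dual (fmap T (F i)) y).
Proof.
  unfold sup at 1. rewrite fmap_sup, sup_pow.
  apply pow_antisym; unfold dual; intro x.
  - intros [z [Hz [f [[i [Hi ->]] Hf]]]]. eauto.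
  - intros [i [Hi [z [Hz Hf]]]]. exists z. split; [|exists (F i); split; [exists i|]]; auto.
Qed.

Lemma dual_fmap_comp {X Y Z : ob A} (g : hom A Y Z) (f : hom A X Y) y :
  dual (fmap T (comp g f)) y = dual (fmap T f) (dual (fmap T g) y).
Proof. rewrite fmap_comp. apply dual_comp, fmap_linear. Qed.

End SlFunctors.

Lemma comp_sup_l (A : SlCat) {X Y Z : ob A} {I} (P : I -> Prop)
  (F : I -> hom A Y Z) (k : hom A X Y) :
  comp (sup P F) k = sup P (fun i => comp (F i) k).
Proof. exact (linear_sup _ P F (proj1 (comp_bimorphism X Y Z) k)). Qed.

Section Generating.

Context {A : SlCat} (B : ob A -> Prop).
Hypothesis HB : sl_generating B.

Record factorization (X : ob A) := Factorization {
  fact_obj : ob A;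
  fact_in : hom A X fact_obj;
  fact_out : hom A fact_obj X
}.

Arguments fact_obj {X}.
Arguments fact_in {X}.
Arguments fact_out {X}.

Definition generating_factorization X (i : factorization X) : Prop :=
  B (fact_obj i) /\ sl_le (comp (fact_out i) (fact_in i)) (idm X).

Lemma idm_sup_factorizations X :
  idm X = sup (generating_factorization X) (fun i => comp (fact_out i) (fact_in i)).
Proof.
  rewrite (HB X). unfold sup. f_equal.
  apply functional_extensionality; intro h; apply propositional_extensionality.
  split.
  - intros [C [r [f [HC [-> Hle]]]]]. exists (Factorization X C r f). split; [split|]; auto.
  - intros [[C r f] [[HC Hle] ->]]. exists C, r, f. auto.
Qed.

Lemma fmap_sup_factorizations (T : SlFun A) X c :
  c = sup (L := PowSL _) (generating_factorization X)
          (fun i => fmap T (fact_out i) (fmap T (fact_in i) c)).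
Proof.
  transitivity (fmap T (idm X) c); [rewrite fmap_id; reflexivity|].
  rewrite idm_sup_factorizations, fmap_sup_family.
  apply (eq_sup (L := PowSL _)). intros i _. rewrite fmap_comp. reflexivity.
Qed.

Context {T T' : SlFun A} {L : SupLattice}.

Definition cone_extension (lam : forall X, Pow (fob T X) -> Pow (fob T' X) -> L)
  X (c : Pow (fob T X)) (y' : Pow (fob T' X)) : L :=
  sup (generating_factorization X)
      (fun i => lam (fact_obj i) (fmap T (fact_in i) c) (dual (fmap T' (fact_out i)) y')).

Lemma cone_eq_extension (lam : forall X, Pow (fob T X) -> Pow (fob T' X) -> L) X :
  (forall y', is_linear (L := PowSL (fob T X)) (M := L) (fun c => lam X c y')) ->
  (forall i, generating_factorization X i -> forall c y',
     lam (fact_obj i) c (dual (fmap T' (fact_out i)) y') = lam X (fmap T (fact_out i) c) y') ->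
  lam X = cone_extension lam X.
Proof.
  intros Hlin Hcone. apply functional_extensionality; intro c.
  apply functional_extensionality; intro y'.
  rewrite (fmap_sup_factorizations T X c) at 1.
  rewrite (linear_sup _ _ _ (Hlin y')).
  apply eq_sup. intros i Hi. symmetry. apply Hcone; auto.
Qed.

Variable lam : forall X, Pow (fob T X) -> Pow (fob T' X) -> L.
Hypothesis Hlin : tensor_arrows T T' L B lam.
Hypothesis Hcone : diamond_cone T T' L B lam.

Lemma cone_extension_bimorphism : tensor_arrows T T' L (fun _ => True) (cone_extension lam).
Proof.
  intros X _. split.
  - intro y'. apply is_linearE. intro S. rewrite sl_join_sup. unfold cone_extension.
    rewrite <- exchange_sup. apply eq_sup. intros i [HC _].
    rewrite (linear_sup _ S (fun x => x) (fmap_linear (s := T) (fact_in i))).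
    apply (linear_sup _ S _ (proj1 (Hlin _ HC) _)).
  - intro c. apply is_linearE. intro S. rewrite sl_join_sup. unfold cone_extension.
    rewrite <- exchange_sup. apply eq_sup. intros i [HC _].
    rewrite (linear_sup _ S (fun x => x) (dual_linear (fmap T' (fact_out i)))).
    apply (linear_sup _ S _ (proj2 (Hlin _ HC) _)).
Qed.

Lemma cone_extension_diamond : diamond_cone T T' L (fun _ => True) (cone_extension lam).
Proof.
  intros X Y h _ _ c y'.
  pose (term i j := lam (fact_obj j)
          (fmap T (comp (fact_in j) (comp h (fact_out i))) (fmap T (fact_in i) c))
          (dual (fmap T' (fact_out j)) y')).
  transitivity (sup (generating_factorization X)
                  (fun i => sup (generating_factorization Y) (term i))).
  - unfold cone_extension. apply eq_sup. intros i [HCi _].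
    rewrite <- dual_fmap_comp, <- (comp_id_l (comp h (fact_out i))).
    rewrite idm_sup_factorizations, comp_sup_l, dual_fmap_sup_family.
    rewrite (linear_sup _ _ _ (proj2 (Hlin _ HCi) _)).
    apply eq_sup. intros j [HCj _].
    rewrite <- comp_assoc, dual_fmap_comp. apply Hcone; auto.
  - rewrite exchange_sup. unfold cone_extension. apply eq_sup. intros j [HCj _].
    rewrite (fmap_sup_factorizations T X c) at 1.
    rewrite (linear_sup _ _ _ (fmap_linear (s := T) h)).
    rewrite (linear_sup _ _ _ (fmap_linear (s := T) (fact_in j))).
    rewrite (linear_sup _ _ _ (proj1 (Hlin _ HCj) _)).
    apply eq_sup. intros i _. unfold term. rewrite !fmap_comp. reflexivity.
Qed.

Lemma cone_extension_extends C : B C -> cone_extension lam C = lam C.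
Proof.
  intro HC. symmetry. apply cone_eq_extension.
  - exact (proj1 (Hlin _ HC)).
  - intros i [Hi _] c y'. apply Hcone; auto.
Qed.

End Generating.

Theorem mainTheorem18 (A : SlCat) (B : ob A -> Prop) (T T' : SlFun A)
  (L : SupLattice)
  (lam : forall X : ob A, Pow (fob T X) -> Pow (fob T' X) -> L) :
  sl_generating B ->
  tensor_arrows T T' L B lam ->
  diamond_cone T T' L B lam ->
  exists ext : forall X : ob A, Pow (fob T X) -> Pow (fob T' X) -> L,
    (tensor_arrows T T' L (fun _ => True) ext /\
     diamond_cone T T' L (fun _ => True) ext /\
     (forall C, B C -> ext C = lam C)) /\
    (forall ext' : forall X : ob A, Pow (fob T X) -> Pow (fob T' X) -> L,
       tensor_arrows T T' L (fun _ => True) ext' ->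
       diamond_cone T T' L (fun _ => True) ext' ->
       (forall C, B C -> ext' C = lam C) ->
       forall X, ext' X = ext X).
Proof.
  intros HB Hlin Hcone.
  exists (cone_extension B lam). split; [split; [|split]|].
  - exact (cone_extension_bimorphism B lam Hlin).
  - exact (cone_extension_diamond B HB lam Hlin Hcone).
  - exact (cone_extension_extends B HB lam Hlin Hcone).
  - intros ext' Hlin' Hcone' Hext X.
    rewrite (cone_eq_extension B HB ext' X (proj1 (Hlin' X I))) by (intros; apply Hcone'; auto).
    apply functional_extensionality; intro c. apply functional_extensionality; intro y'.
    apply eq_sup. intros i [HC _]. rewrite (Hext _ HC). reflexivity.
Qed.
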